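(* Let $g_{Sol}=e^{2z}\,dx^{2}+e^{-2z}\,dy^{2}+dz^{2}$ be the Sol metric on $\mathbb{R}^3$ with coordinates $(x,y,z)$. There exists no harmonic Riemannian submersion $\pi:(\mathbb{R}^3,g_{Sol})\to (N^2,h)$, no matter what the $2$-dimensional Riemannian manifold $(N^2,h)$ is.
   Context: All manifolds and maps are smooth. Sol space is the Riemannian manifold $(\mathbb{R}^3,g_{Sol})$ with $g_{Sol}=e^{2z}dx^2+e^{-2z}dy^2+dz^2$. A map $\varphi:(M,g)\to(N,h)$ between Riemannian manifolds is harmonic if its tension field $\tau(\varphi)=\mathrm{Trace}_g\nabla d\varphi$ vanishes identically (equivalently, it is a critical point of the energy $\frac12\int_\Omega|d\varphi|^2$ over every compact domain $\Omega$). A harmonic Riemannian submersion is a Riemannian submersion that is a harmonic map. *)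

(* Defs.v *)
From HB Require Import structures.
From mathcomp Require Import all_boot all_order all_algebra.
From mathcomp Require Import all_classical all_reals all_analysis.

Set Implicit Arguments.
Unset Strict Implicit.
Unset Printing Implicit Defensive.

Import Order.TTheory GRing.Theory Num.Theory.
Import numFieldNormedType.Exports.

Local Open Scope classical_set_scope.
Local Open Scope ring_scope.

Definition partial (R : realType) (n : nat) (V : normedModType R) (i : 'I_n)
    (f : 'rV[R]_n -> V) (x : 'rV[R]_n) : V :=
  'D_(delta_mx 0 i) f x.

(* The set U is meant to be open: differentiability at x uses the values of f
   around x. *)
Fixpoint ck_on (R : realType) (n : nat) (V : normedModType R) (k : nat)
    (U : set 'rV[R]_n) (f : 'rV[R]_n -> V) : Prop :=
  if k is k'.+1 then
    (forall x, U x -> differentiable f x) /\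
    (forall i : 'I_n, ck_on k' U (partial i f))
  else forall x, U x -> {for x, continuous f}.

Definition smooth_on (R : realType) (n : nat) (V : normedModType R)
    (U : set 'rV[R]_n) (f : 'rV[R]_n -> V) : Prop :=
  forall k : nat, ck_on k U f.

(* A homeomorphism from an open set of M onto an open set of R^n; the values of
   [coord] outside [dom], and of [param] outside [coord @` dom], are
   irrelevant. *)
Record chart (R : realType) (n : nat) (M : topologicalType) := Chart {
  dom : set M ;
  coord : M -> 'rV[R]_n ;
  param : 'rV[R]_n -> M ;
  dom_open : open dom ;
  img_open : open (coord @` dom) ;
  coordK : forall p, dom p -> param (coord p) = p ;
  coord_continuous_on : forall p, dom p -> {for p, continuous coord} ;
  param_continuous_on : forall x, (coord @` dom) x -> {for x, continuous param}
}.

Definition chart_img (R : realType) (n : nat) (M : topologicalType)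
    (c : chart R n M) : set 'rV[R]_n := coord c @` dom c.

(* The expression of f in the charts c and d. *)
Definition in_charts (R : realType) (m n : nat) (M N : topologicalType)
    (c : chart R m M) (d : chart R n N) (f : M -> N) : 'rV[R]_m -> 'rV[R]_n :=
  fun x => coord d (f (param c x)).

Definition smooth_in_charts (R : realType) (m n : nat) (M N : topologicalType)
    (c : chart R m M) (d : chart R n N) (f : M -> N) : Prop :=
  smooth_on (coord c @` (dom c `&` f @^-1` dom d)) (in_charts c d f).

(* The smooth structure is given by an atlas, which need not be maximal. *)
Record manifold (R : realType) (n : nat) := Manifold {
  manifold_carrier :> topologicalType ;
  manifold_hausdorff : hausdorff_space manifold_carrier ;
  manifold_second_countable : @second_countable manifold_carrier ;
  chart_index : Type ;
  atlas : chart_index -> chart R n manifold_carrier ;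
  atlas_cover : forall p, exists i, dom (atlas i) p ;
  atlas_smooth : forall i j, smooth_in_charts (atlas i) (atlas j) id
}.

Definition smooth_map (R : realType) (m n : nat) (M : manifold R m)
    (N : manifold R n) (f : M -> N) : Prop :=
  continuous f /\
  forall (i : chart_index M) (j : chart_index N),
    smooth_in_charts (atlas i) (atlas j) f.

(* Tangent vectors at p, read in a chart around p, are row vectors, on which
   ['J f x] acts by right multiplication. *)
Definition inner (R : realType) (n : nat) (G : 'M[R]_n) (u v : 'rV[R]_n) : R :=
  (u *m G *m v^T) 0 0.

(* [metric i x] is the Gram matrix (g_ab) of the coordinate frame of the chart
   [atlas i] at the point of coordinates x. *)
Record riemannian_manifold (R : realType) (n : nat) := RiemannianManifold {
  underlying_manifold :> manifold R n ;
  metric : chart_index underlying_manifold -> 'rV[R]_n -> 'M[R]_n ;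
  metric_smooth : forall i, smooth_on (chart_img (atlas i)) (metric i) ;
  metric_sym : forall i x, chart_img (atlas i) x -> (metric i x)^T = metric i x ;
  metric_pos : forall i x, chart_img (atlas i) x ->
    forall u, u != 0 -> 0 < inner (metric i x) u u ;
  metric_compat : forall i j p, dom (atlas i) p -> dom (atlas j) p ->
    let T := in_charts (atlas i) (atlas j) id in
    forall u v,
      inner (metric i (coord (atlas i) p)) u v =
      inner (metric j (coord (atlas j) p))
        (u *m 'J T (coord (atlas i) p)) (v *m 'J T (coord (atlas i) p))
}.

(* The Christoffel symbol Gamma^k_ij of the metric G. *)
Definition christoffel (R : realType) (n : nat) (G : 'rV[R]_n -> 'M[R]_n)
    (k i j : 'I_n) (x : 'rV[R]_n) : R :=
  2^-1 * \sum_(l < n) invmx (G x) k l *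
    (partial i (fun y => G y j l) x + partial j (fun y => G y i l) x
     - partial l (fun y => G y i j) x).

(* The (i, j) coefficient of the a-th component of the second fundamental form
   nabla dF of F : (R^m, G) -> (R^n, H). *)
Definition second_fundamental_form (R : realType) (m n : nat)
    (G : 'rV[R]_m -> 'M[R]_m) (H : 'rV[R]_n -> 'M[R]_n)
    (F : 'rV[R]_m -> 'rV[R]_n) (a : 'I_n) (i j : 'I_m) (x : 'rV[R]_m) : R :=
  let Fc (b : 'I_n) (y : 'rV[R]_m) : R := F y 0 b in
  partial i (partial j (Fc a)) x
  - \sum_(k < m) christoffel G k i j x * partial k (Fc a) x
  + \sum_(b < n) \sum_(c < n)
      christoffel H a b c (F x) * partial i (Fc b) x * partial j (Fc c) x.

Definition tension (R : realType) (m n : nat)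
    (G : 'rV[R]_m -> 'M[R]_m) (H : 'rV[R]_n -> 'M[R]_n)
    (F : 'rV[R]_m -> 'rV[R]_n) (x : 'rV[R]_m) : 'rV[R]_n :=
  \row_(a < n) \sum_(i < m) \sum_(j < m)
    invmx (G x) i j * second_fundamental_form G H F a i j x.

Definition harmonic_map (R : realType) (m n : nat) (M : riemannian_manifold R m)
    (N : riemannian_manifold R n) (f : M -> N) : Prop :=
  smooth_map f /\
  forall (i : chart_index M) (j : chart_index N) (p : M),
    dom (atlas i) p -> dom (atlas j) (f p) ->
    tension (metric i) (metric j) (in_charts (atlas i) (atlas j) f)
      (coord (atlas i) p) = 0.

Definition horizontal (R : realType) (m n : nat) (G : 'M[R]_m)
    (J : 'M[R]_(m, n)) (u : 'rV[R]_m) : Prop :=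
  forall w : 'rV[R]_m, w *m J = 0 -> inner G u w = 0.

Definition riemannian_submersion (R : realType) (m n : nat)
    (M : riemannian_manifold R m) (N : riemannian_manifold R n)
    (f : M -> N) : Prop :=
  smooth_map f /\
  forall (i : chart_index M) (j : chart_index N) (p : M),
    dom (atlas i) p -> dom (atlas j) (f p) ->
    let x := coord (atlas i) p in
    let J := 'J (in_charts (atlas i) (atlas j) f) x in
    row_full J /\
    forall u v : 'rV[R]_m,
      horizontal (metric i x) J u -> horizontal (metric i x) J v ->
      inner (metric j (coord (atlas j) (f p))) (u *m J) (v *m J) =
      inner (metric i x) u v.

Section RowVectorSpace.
Context {R : realType} {n : nat}.

Lemma rV_hausdorff : hausdorff_space 'rV[R]_n.
Proof. exact: norm_hausdorff. Qed.

Lemma rV_second_countable : @second_countable 'rV[R]_n.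
Proof.
pose B (t : 'rV[rat]_n * nat) : set 'rV[R]_n :=
  ball (map_mx ratr t.1 : 'rV[R]_n) (t.2.+1%:R^-1 : R).
exists (range B); first exact: (sub_countable (card_image_le _ _)).
split=> [_ [t _ <-]|x A /nbhs_ballP[e /= e0 eA]]; first exact: ball_open.
have [k ke] : exists k : nat, (k.+1%:R^-1 : R) < e / 2.
  have /ltr_add_invr[k kk] : (0 : R) < e / 2 by rewrite divr_gt0.
  by exists k; rewrite add0r in kk.
have k0 : (0 : R) < k.+1%:R^-1 by rewrite invr_gt0.
have /choice[q qP] : forall j, exists q : rat,
    ball (x 0 j) (k.+1%:R^-1 : R) (ratr q : R).
  move=> j.
  have /rat_in_itvoo[q] : x 0 j - k.+1%:R^-1 < x 0 j + k.+1%:R^-1 :> R.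
    by rewrite ltrD2l gtrN.
  by rewrite in_itv/= => qx; exists q; rewrite -ball_normE/= distrC ltr_distl.
have xq : ball x (k.+1%:R^-1 : R) (map_mx ratr (\row_j q j) : 'rV[R]_n).
  by split=> // i j; rewrite ord1 !mxE; exact: qP.
exists (B (\row_j q j, k)); first split.
- by exists (\row_j q j, k).
- exact: ball_sym.
- move=> y /= By; apply: eA; rewrite /= (splitr e).
  exact: (ball_triangle (le_ball (ltW ke) xq) (le_ball (ltW ke) By)).
Qed.

Lemma ck_on_cst (V : normedModType R) k (U : set 'rV[R]_n) (a : V) :
  ck_on k U (cst a).
Proof.
elim: k a => [|k IH] a /=; first by move=> x _; exact: cst_continuous.
split=> [x _|i]; first exact: differentiable_cst.
suff -> : partial i (cst a : 'rV[R]_n -> V) = cst 0 by exact: IH.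
by apply/funext => x; rewrite /partial derive_cst.
Qed.

Lemma smooth_on_id (U : set 'rV[R]_n) : smooth_on U (@id 'rV[R]_n).
Proof.
case=> [|k] /=; first by move=> x _; exact: cvg_id.
split=> [x _|i]; first by have [] := is_diff_id x.
suff -> : partial i (@id 'rV[R]_n) = cst (delta_mx 0 i) by exact: ck_on_cst.
by apply/funext => x; rewrite /partial derive_id.
Qed.

Lemma eq_smooth_on (V : normedModType R) (U : set 'rV[R]_n)
  (f g : 'rV[R]_n -> V) : f =1 g -> smooth_on U g -> smooth_on U f.
Proof. by move=> /funext ->. Qed.

Definition rV_chart : chart R n 'rV[R]_n.
Proof.
refine (@Chart R n 'rV[R]_n setT id id openT _ _ _ _) => //.
- by rewrite image_id; exact: openT.
- by move=> p _; exact: cvg_id.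
- by move=> p _; exact: cvg_id.
Defined.

Definition rV_manifold : manifold R n.
Proof.
refine (@Manifold R n 'rV[R]_n rV_hausdorff rV_second_countable unit
  (fun=> rV_chart) _ _).
- by move=> p; exists tt.
- by move=> _ _; exact: smooth_on_id.
Defined.

Lemma jacobian_id (x : 'rV[R]_n) : 'J (@id 'rV[R]_n) x = 1%:M.
Proof.
by apply/row_matrixP => i; rewrite !rowE -deriveEjacobian ?mulmx1 ?derive_id//.
Qed.

End RowVectorSpace.
Arguments rV_manifold : clear implicits.

(* R^n with its standard smooth structure and the metric whose Gram matrix in
   the standard coordinates is G. *)
Definition rV_riemannian (R : realType) (n : nat) (G : 'rV[R]_n -> 'M[R]_n)
    (G_smooth : smooth_on setT G) (G_sym : forall x, (G x)^T = G x)
    (G_pos : forall x u, u != 0 -> 0 < inner (G x) u u) :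
  riemannian_manifold R n.
Proof.
refine (@RiemannianManifold R n (rV_manifold R n) (fun=> G) _ _ _ _).
- by move=> i; rewrite /chart_img/= image_id.
- by move=> i x _; exact: G_sym.
- by move=> i x _; exact: G_pos.
- by move=> i j p _ _ T u v; rewrite /T /in_charts/= jacobian_id !mulmx1.
Defined.

(* The row vector x stands for (x, y, z), with z = x 0 2. *)
Definition sol_metric (R : realType) (x : 'rV[R]_3) : 'M[R]_3 :=
  diag_mx (\row_i [:: expR (2 * x 0 2); expR (- 2 * x 0 2); 1]`_i).

Section SolSpace.
Context {R : realType}.

Local Notation exp_term c B :=
  (fun x : 'rV[R]_3 => expR (c * x 0 2) *: (B : 'M[R]_3)).

Lemma is_diff_exp_term (c : R) (B : 'M[R]_3) (x : 'rV[R]_3) :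
  is_diff x (exp_term c B)
    (fun v => (c * v 0 2 * expR (c * x 0 2)) *: B).
Proof.
pose l : 'rV[R]_3 -> R := fun v => v 0 2.
have lD : linear l by move=> a u v; rewrite /l !mxE.
pose l' : {linear 'rV[R]_3 -> R} :=
  HB.pack l (GRing.isLinear.Build R 'rV[R]_3 R _ l lD).
have lc : continuous l' by exact: coord_continuous.
have dl : is_diff x l l.
  split; first exact: (linear_differentiable x lc).
  exact: (diff_lin x lc).
have de : is_diff (c * l x) (expR : R -> R) (fun h => h * expR (c * l x)).
  have [d1 d2] := is_derive_expR (c * l x).
  have d3 : differentiable (expR : R -> R) (c * l x) by exact/derivable1_diffP.
  split=> //; apply/funext => h.
  by rewrite -[h in LHS]mulr1 -[h * 1]/(h *: (1 : R)) linearZ/= -deriveE// d2.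
have dcl : is_diff x (c \*: l) (c \*: l) by exact: is_diffZ.
have dg := is_diff_scalel (expR (c * l x)) B.
apply: (is_diff_eq (is_diff_comp (is_diff_comp dcl de) dg)).
by apply/funext.
Qed.

Lemma ck_on_exp_combination k (U : set 'rV[R]_3) (A B C : 'M[R]_3) (a b : R) :
  ck_on k U (cst A + exp_term a B + exp_term b C).
Proof.
have dS A' B' C' x := is_diffD
  (is_diffD (is_diff_cst A' x) (is_diff_exp_term a B' x))
  (is_diff_exp_term b C' x).
elim: k A B C => [|k IH] A B C.
  by move=> x _; have [/differentiable_continuous] := dS A B C x.
split=> [x _|i]; first by have [] := dS A B C x.
have := IH 0 ((a * (delta_mx 0 i : 'rV[R]_3) 0 2) *: B)
             ((b * (delta_mx 0 i : 'rV[R]_3) 0 2) *: C).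
congr ck_on; apply/funext => x; rewrite /partial.
have [dF dE] := dS A B C x; rewrite (deriveE _ dF) dE !fctE.
by rewrite !scalerA ![expR _ * _]mulrC.
Qed.

Lemma sol_metricE : @sol_metric R =
  cst (delta_mx 2 2) + exp_term 2 (delta_mx 0 0) + exp_term (- 2) (delta_mx 1 1).
Proof.
apply/funext => x; apply/matrixP => i j; rewrite !fctE !mxE.
by case: i => [[|[|[|]]] ?] //; case: j => [[|[|[|]]] ?] //=;
  rewrite /= ?(mulr1, mulr0, addr0, add0r, mulr1n, mulr0n).
Qed.

Lemma sol_metric_smooth : smooth_on setT (@sol_metric R).
Proof. by rewrite sol_metricE => k; exact: ck_on_exp_combination. Qed.

Lemma sol_metric_sym (x : 'rV[R]_3) : (sol_metric x)^T = sol_metric x.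
Proof. exact: tr_diag_mx. Qed.

Lemma sol_metric_pos (x u : 'rV[R]_3) :
  u != 0 -> 0 < inner (sol_metric x) u u.
Proof.
move=> /rV0Pn[j uj]; rewrite /inner /sol_metric mul_mx_diag mxE.
have d0 i : 0 < ([:: expR (2 * x 0 2); expR (- 2 * x 0 2); 1]`_(i : 'I_3) : R).
  by case: i => [[|[|[|]]] ?] //=; rewrite ?expR_gt0.
rewrite (bigD1 j)//= ltr_wpDr//; last first.
  by rewrite !mxE mulrAC -expr2 mulr_gt0// exprn_even_gt0.
by apply: sumr_ge0 => i _; rewrite !mxE mulrAC -expr2 mulr_ge0 ?sqr_ge0// ltW.
Qed.

End SolSpace.

Definition sol (R : realType) : riemannian_manifold R 3 :=
  rV_riemannian (@sol_metric_smooth R) (@sol_metric_sym R) (@sol_metric_pos R).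

(* Main.v *)
(* A harmonic Riemannian submersion to a surface has minimal, hence geodesic,
   fibres. Along its unit vertical field V, the submersion property kills the
   horizontal part of L_V g and the geodesic property kills the mixed part, so
   V is a unit Killing field. Sol has none, even locally: along the geodesics
   in the z direction the x- and y-components of V in the left-invariant
   orthonormal frame satisfy v'' = v while the z-component is constant, so
   |V| = 1 forces the first two components to vanish; but E_z = d/dz is not
   Killing. *)

From HB Require Import structures.
Require Import Defs.
From mathcomp Require Import all_boot all_order all_algebra.
From mathcomp Require Import all_classical all_reals all_analysis.
From mathcomp Require Import ring lra.

Set Implicit Arguments.
Unset Strict Implicit.
Unset Printing Implicit Defensive.

Import Order.TTheory GRing.Theory Num.Theory.
Import numFieldNormedType.Exports.

Local Open Scope classical_set_scope.
Local Open Scope ring_scope.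

(** * Linear algebra of a submersion with one-dimensional fibres *)

(** The geometry is carried by matrices in the orthonormal frame of Sol. If the rows of [P] are the
    gradients of the components of the submersion, the submersion property becomes
    [P *m P^T *m H = 1%:M]: the Gram matrix of the gradients inverts the target metric along the
    map. Differentiated, this identity determines the Hessians on horizontal vectors, as Koszul's
    formula determines a connection, and their horizontal trace then cancels the target Christoffel
    terms of the tension exactly. Vanishing tension leaves Hess(v, v) = 0 for the unit vertical [v],
    which is the geodesic condition on the fibres.

    On the Sol side, [v] is carried as a once differentiable field, so v'' = v cannot be had by
    differentiating the Killing equation at will. But [v 2] does not change along z, so its x- and
    y-derivatives are constant on each z-line; the equations for the other two components then
    become linear with explicit coefficients, and their right-hand sides are differentiable
    again. *)

Lemma orthonormal_completion (F : fieldType) (n : nat) (P : 'M[F]_(n, n + 1))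
    (H : 'M[F]_n) (v : 'rV[F]_(n + 1)) :
  P *m P^T *m H = 1%:M -> P *m v^T = 0 -> v *m v^T = 1%:M ->
  P^T *m H *m P + v^T *m v = 1%:M.
Proof.
move=> KH Pv vv.
have vP : v *m P^T = 0 by rewrite -[v]trmxK -trmx_mul Pv trmx0.
(* A right inverse of a square matrix is also a left inverse; the product in the other order splits
   the identity into the horizontal and vertical projections. *)
pose M := col_mx P v.
have MM : M *m (row_mx (P^T *m H) v^T) = 1%:M.
  rewrite mul_col_row !mulmxA KH vP mul0mx Pv vv.
  by rewrite -scalar_mx_block.
by rewrite -(mulmx1C MM) mul_row_col.
Qed.

Lemma mxtrace_mulE (F : comPzRingType) (m n : nat) (A : 'M[F]_(m, n))
    (B : 'M[F]_(n, m)) : \tr (A *m B) = \sum_i \sum_j A i j * B j i.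
Proof. by apply: eq_bigr => i _; rewrite mxE. Qed.

(** Exchanging [b] and [c] identifies the first two terms of the Christoffel symbol, since [K] is
    symmetric, and the third contracts to a trace. Here [K] plays the inverse metric and [D] the
    derivatives of the metric. *)
Lemma christoffel_traceE (F : numFieldType) (n : nat) (K : 'M[F]_n)
    (D : 'I_n -> 'M[F]_n) (a : 'I_n) :
  K^T = K -> (forall c, (D c)^T = D c) ->
  \sum_b \sum_c (2^-1 * \sum_l K a l * (D b c l + D c b l - D l b c)) * K b c =
  \sum_b (K *m D b *m K) a b - 2^-1 * \sum_l K a l * \tr (D l *m K).
Proof.
move=> KT DT.
have KTE i j : K i j = K j i by rewrite -[in LHS]KT mxE.
have DTE c i j : D c i j = D c j i by rewrite -[in LHS]DT mxE.
pose S1 := \sum_b \sum_c (\sum_l K a l * D b c l) * K b c.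
pose S2 := \sum_b \sum_c (\sum_l K a l * D c b l) * K b c.
pose S3 := \sum_b \sum_c (\sum_l K a l * D l b c) * K b c.
have S1E : S1 = \sum_b (K *m D b *m K) a b.
  apply: eq_bigr => b _; rewrite mxE; apply: eq_bigr => c _.
  rewrite mxE KTE; congr (_ * _); apply: eq_bigr => l _; congr (_ * _).
  exact: DTE.
have S2E : S2 = S1.
  rewrite /S2 exchange_big; apply: eq_bigr => b _; apply: eq_bigr => c _.
  by rewrite KTE.
have S3E : S3 = \sum_l K a l * \tr (D l *m K).
  rewrite /S3; under eq_bigr => b _ do
    (under eq_bigr => c _ do rewrite mulr_suml; rewrite exchange_big).
  rewrite exchange_big; apply: eq_bigr => l _; rewrite mxtrace_mulE mulr_sumr.
  apply: eq_bigr => b _; rewrite mulr_sumr; apply: eq_bigr => c _.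
  by rewrite -mulrA [K c b]KTE.
rewrite -S1E -S3E; transitivity (2^-1 * (S1 + S2 - S3)); last first.
  by rewrite S2E; field.
rewrite mulrBr mulrDr !mulr_sumr -big_split -sumrB; apply: eq_bigr => b _ /=.
rewrite !mulr_sumr -big_split -sumrB; apply: eq_bigr => c _ /=.
rewrite !mulrA -!mulrDl -mulrBl -!mulrDr -mulrBr; congr (_ * _ * _).
rewrite -big_split -sumrB; apply: eq_bigr => l _ /=.
by rewrite !mulrDr mulrN.
Qed.

(* The Koszul formula: [X b] is the Hessian of the b-th component on horizontal
   gradients and K is the inverse metric of the target. *)
Lemma mxtrace_hessianE (F : numFieldType) (n : nat) (K H : 'M[F]_n)
    (D X : 'I_n -> 'M[F]_n) (a : 'I_n) :
  K *m H = 1%:M -> K^T = K -> (forall b, (X b)^T = X b) ->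
  (forall a b c, X b a c + X a b c = - \sum_f (K *m D f *m K) a b * K f c) ->
  \tr (H *m X a) =
  2^-1 * \sum_l K a l * \tr (D l *m K) - \sum_b (K *m D b *m K) a b.
Proof.
move=> KH KT XT XE.
have HK := mulmx1C KH.
have KTE i j : K i j = K j i by rewrite -[in LHS]KT mxE.
have XTE c i j : X c i j = X c j i by rewrite -[in LHS]XT mxE.
pose T a b c := - \sum_f (K *m D f *m K) a b * K f c.
(* Two of the three cyclic instances of the hypothesis minus the third isolate one value, because
   every [X] is symmetric. *)
have aE b c : X a b c = 2^-1 * (T a b c + T a c b - T b c a).
  rewrite /T -!XE (XTE b c a) (XTE c b a) (XTE a c b) [X c a b]XTE.
  by field.
pose S1 := \sum_b \sum_c H b c * T a c b.
pose S2 := \sum_b \sum_c H b c * T a b c.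
pose S3 := \sum_b \sum_c H b c * T b c a.
have HT : H^T = H.
  by rewrite -[H^T]mulmx1 -KH -{1}KT mulmxA -trmx_mul KH trmx1 mul1mx.
have HTE i j : H i j = H j i by rewrite -[in LHS]HT mxE.
have S1E : S1 = - \sum_b (K *m D b *m K) a b.
  transitivity (- \sum_f \sum_c (K *m D f *m K) a c * (K *m H) f c).
    rewrite /S1 /T; under eq_bigr => b _ do
      (under eq_bigr => c _ do rewrite mulrN mulr_sumr;
     rewrite sumrN exchange_big).
    rewrite sumrN exchange_big; congr (- _); apply: eq_bigr => f _ /=.
    rewrite exchange_big; apply: eq_bigr => c _; rewrite [X in _ * X]mxE mulr_sumr.
    by apply: eq_bigr => b _; rewrite mulrC mulrA.
  congr (- _); apply: eq_bigr => f _.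
  rewrite KH (bigD1 f)//= [1%:M f f]mxE eqxx mulr1.
  rewrite big1 ?addr0// => c /negbTE cf.
  by rewrite [1%:M f c]mxE eq_sym cf mulr0.
have S2E : S2 = S1.
  rewrite /S2 exchange_big; apply: eq_bigr => b _; apply: eq_bigr => c _.
  by rewrite HTE.
have S3E : S3 = - \sum_l K a l * \tr (D l *m K).
  rewrite /S3 /T; under eq_bigr => b _ do
    (under eq_bigr => c _ do rewrite mulrN mulr_sumr;
     rewrite sumrN exchange_big).
  rewrite sumrN exchange_big; congr (- _); apply: eq_bigr => f _ /=.
  have -> : \tr (D f *m K) = \tr (K *m D f *m K *m H).
    by rewrite -[_ *m K *m H]mulmxA KH mulmx1 mxtrace_mulC.
  rewrite mxtrace_mulE mulr_sumr; apply: eq_bigr => b _; rewrite mulr_sumr.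
  by apply: eq_bigr => c _; rewrite [H b c]HTE [K f a]KTE; ring.
rewrite mxtrace_mulE; transitivity (2^-1 * (S1 + S2 - S3)); last first.
  by rewrite S2E S1E S3E; field.
rewrite mulrBr mulrDr !mulr_sumr -big_split -sumrB; apply: eq_bigr => b _ /=.
rewrite !mulr_sumr -big_split -sumrB; apply: eq_bigr => c _ /=.
by rewrite XTE aE; ring.
Qed.

(* The rows of P are the gradients of the components of the submersion in an
   orthonormal frame, A a is the Hessian of the a-th component, H the metric of
   the target, D c its c-th partial derivative, and v the unit vertical vector;
   the last hypothesis says that the tension vanishes. *)
Lemma vertical_hessian_eq0 (F : numFieldType) (n : nat) (P : 'M[F]_(n, n + 1))
    (H : 'M[F]_n) (D : 'I_n -> 'M[F]_n) (A : 'I_n -> 'M[F]_(n + 1))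
    (v : 'rV[F]_(n + 1)) :
  let K := P *m P^T in
  K *m H = 1%:M -> P *m v^T = 0 -> v *m v^T = 1%:M ->
  (forall c, (D c)^T = D c) ->
  (forall a, (A a)^T = A a) ->
  (forall a b, row a P *m A b + row b P *m A a =
     - \sum_c (K *m D c *m K) a b *: row c P) ->
  (forall a, \tr (A a) + \sum_b \sum_c
     (2^-1 * \sum_l K a l * (D b c l + D c b l - D l b c)) * K b c = 0) ->
  forall a, v *m A a *m v^T = 0.
Proof.
move=> K KH Pv vv DT AT dK tau a.
have KT : K^T = K by rewrite trmx_mul trmxK.
have compl := orthonormal_completion KH Pv vv.
have XE b c e : (P *m A c *m P^T) b e + (P *m A b *m P^T) c e =
    - \sum_f (K *m D f *m K) b c * K f e.
  have := congr1 (fun w => (w *m P^T) 0 e) (dK b c).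
  rewrite mulmxDl -!row_mul mulNmx mulmx_suml !mxE => ->.
  congr (- _); rewrite summxE; apply: eq_bigr => f _.
  by rewrite -scalemxAl -row_mul !mxE.
have XT b : (P *m A b *m P^T)^T = P *m A b *m P^T.
  by rewrite !trmx_mul trmxK AT mulmxA.
have := tau a; rewrite christoffel_traceE//.
have -> : \tr (A a) = \tr (A a *m (P^T *m H *m P)) + \tr (A a *m (v^T *m v)).
  by rewrite -mxtraceD -mulmxDr compl mulmx1.
have -> : \tr (A a *m (P^T *m H *m P)) = \tr (H *m (P *m A a *m P^T)).
  by rewrite [RHS]mxtrace_mulC -!mulmxA [RHS]mxtrace_mulC !mulmxA.
(* The horizontal trace is now the opposite of the Christoffel contraction, so the tension reduces
   to its vertical term. *)
rewrite (mxtrace_hessianE (X := fun b => P *m A b *m P^T) a KH KT XT XE).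
rewrite mulmxA mxtrace_mulC mulmxA [\tr _]big_ord1 => vAv.
by apply/matrixP => i j; rewrite !ord1 [RHS]mxE -vAv; ring.
Qed.

(* N stands for the covariant derivative of the unit vertical field. *)
Lemma antisymmetric_of_tension (F : numFieldType) (n : nat)
    (P : 'M[F]_(n, n + 1)) (H : 'M[F]_n) (D : 'I_n -> 'M[F]_n)
    (A : 'I_n -> 'M[F]_(n + 1)) (v : 'rV[F]_(n + 1)) (N : 'M[F]_(n + 1)) :
  let K := P *m P^T in
  K *m H = 1%:M -> P *m v^T = 0 -> v *m v^T = 1%:M ->
  (forall c, (D c)^T = D c) ->
  (forall a, (A a)^T = A a) ->
  (forall a b, row a P *m A b + row b P *m A a =
     - \sum_c (K *m D c *m K) a b *: row c P) ->
  (forall a, \tr (A a) + \sum_b \sum_c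
     (2^-1 * \sum_l K a l * (D b c l + D c b l - D l b c)) * K b c = 0) ->
  N *m v^T = 0 ->
  (forall a, N *m (row a P)^T = - (A a *m v^T)) ->
  N + N^T = 0.
Proof.
move=> K KH Pv vv DT AT dK tau Nv NP.
have vAv := vertical_hessian_eq0 KH Pv vv DT AT dK tau.
have compl := orthonormal_completion KH Pv vv.
(* [S] is the Lie derivative of the metric along the vertical field. It is tested on [v] and the
   rows of [P], which together form a basis. *)
pose S := N + N^T.
have ST : S^T = S by rewrite /S linearD/= trmxK addrC.
have vN : v *m N^T = 0 by rewrite -[v]trmxK -trmx_mul Nv trmx0.
have rv b : row b P *m v^T = 0 by rewrite -row_mul Pv row0.
have vr b : v *m (row b P)^T = 0 by rewrite -[v]trmxK -trmx_mul rv trmx0.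
have rN b : row b P *m N^T = - (v *m A b).
  by rewrite -[row b P]trmxK -trmx_mul NP linearN/= trmx_mul trmxK AT.
have vSv : v *m S *m v^T = 0.
  by rewrite mulmxDr vN addr0 -mulmxA Nv mulmx0.
(* Mixed part: differentiating orthogonality to a gradient turned [N] into a Hessian, so what
   remains is Hess(v, v), zero by the tension equation. *)
have rSv b : row b P *m S *m v^T = 0.
  by rewrite mulmxDr mulmxDl -mulmxA Nv mulmx0 rN add0r mulNmx vAv oppr0.
have tr1 (M : 'M[F]_1) : M^T = M by apply/matrixP => i j; rewrite !ord1 mxE.
(* Horizontal part: it is the vertical derivative of the Gram matrix [K], whose differential is a
   combination of rows of [P] and so vanishes on [v]. *)
have rSr b c : row b P *m S *m (row c P)^T = 0.
  rewrite mulmxDr mulmxDl rN -mulmxA NP mulmxN mulNmx mulmxA.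
  have -> : v *m A b *m (row c P)^T = row c P *m A b *m v^T.
    by rewrite -[LHS]tr1 !trmx_mul trmxK AT mulmxA.
  rewrite -opprD -mulmxDl [_ + _]dK mulNmx mulmx_suml opprK big1// => f _.
  by rewrite -scalemxAl rv scaler0.
have PSv : P *m S *m v^T = 0.
  by apply/row_matrixP => b; rewrite !row_mul rSv row0.
have PSP : P *m S *m P^T = 0.
  apply/matrixP => b c; rewrite [RHS]mxE.
  have /(congr1 (fun M : 'M[F]_1 => M 0 0)) := rSr b c; rewrite [RHS]mxE => <-.
  by rewrite mxE [RHS]mxE; apply: eq_bigr => j _; rewrite -row_mul !mxE.
have vSP : v *m S *m P^T = 0.
  by apply: trmx_inj; rewrite !trmx_mul trmxK ST mulmxA PSv trmx0.
have PS : P *m S = 0.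
  by rewrite -[LHS]mulmx1 -compl mulmxDr !mulmxA PSP PSv !mul0mx addr0.
have vS : v *m S = 0.
  by rewrite -[LHS]mulmx1 -compl mulmxDr !mulmxA vSP vSv !mul0mx addr0.
by rewrite -[LHS]mul1mx -compl mulmxDl -!mulmxA PS vS !mulmx0 addr0.
Qed.

(** * Symmetry of second derivatives *)

Lemma is_derive_line (R : numFieldType) (V W : normedModType R) (f : V -> W)
    (x v : V) (t : R) :
  derivable f (x + t *: v) v ->
  is_derive t 1 (fun s => f (x + s *: v)) ('D_v f (x + t *: v)).
Proof.
have E : (fun h : R => h^-1 *: (((fun s => f (x + s *: v)) \o shift t) (h *: 1)
                        - f (x + t *: v))) =
         (fun h => h^-1 *: ((f \o shift (x + t *: v)) (h *: v) - f (x + t *: v))).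
  apply/funext => h; congr (_ *: (f _ - _)) => /=.
  by rewrite scalerDl [h *: 1]mulr1 addrCA.
by move=> df; split; [rewrite /derivable E | rewrite /derive E].
Qed.

Lemma MVT_closed (R : realType) (f df : R -> R) (a b : R) : a < b ->
  (forall t, a <= t <= b -> is_derive t 1 f (df t)) ->
  exists2 c, a < c < b & f b - f a = df c * (b - a).
Proof.
move=> ab dfE; have [t||c cab fE] := @MVT R f df a b ab.
- by rewrite in_itv => /andP[at_ tb]; apply: dfE; rewrite !ltW.
- apply: continuous_in_subspaceT => t /[!inE]/= /[!in_itv]/= tab.
  exact/differentiable_continuous/derivable1_diffP/
    (@ex_derive _ _ _ _ _ _ _ (dfE _ tab)).
- by exists c => //; move: cab; rewrite in_itv.
Qed.

(** The mean value theorem is used twice: along [u] on the difference of [f] between two parallel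
    sides of the parallelogram, then along [w] on the derivative ['D_u f] so produced. *)
Lemma second_difference (R : realType) (V : normedModType R) (f : V -> R)
    (x u w : V) (s : R) : 0 < s ->
  (forall a b, 0 <= a <= s -> 0 <= b <= s ->
    derivable f (x + a *: u + b *: w) u /\
    derivable ('D_u f) (x + a *: u + b *: w) w) ->
  exists a b, [/\ 0 < a < s, 0 < b < s &
    f (x + s *: u + s *: w) - f (x + s *: u) - f (x + s *: w) + f x =
    'D_w ('D_u f) (x + a *: u + b *: w) * (s * s)].
Proof.
move=> s0 df; have ss : 0 <= s <= s by rewrite (ltW s0) lexx.
have s0s : (0 : R) <= 0 <= s by rewrite (ltW s0) lexx.
pose g t := f (x + s *: w + t *: u) - f (x + t *: u).
pose dg t := 'D_u f (x + s *: w + t *: u) - 'D_u f (x + t *: u).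
have [t ts|a /[dup] as_ /andP[a0 /ltW a1]] := @MVT_closed _ g dg 0 s s0.
  apply: is_deriveB; apply: is_derive_line.
    by rewrite addrAC; have [] := df t s ts ss.
  by have [] := df t 0 ts s0s; rewrite scale0r addr0.
pose h t := 'D_u f (x + a *: u + t *: w).
pose dh t := 'D_w ('D_u f) (x + a *: u + t *: w).
have [t ts|b bs] := @MVT_closed _ h dh 0 s s0.
  by apply: is_derive_line; have [|] := df a t _ ts; rewrite ?(ltW a0).
rewrite /h /dh /g /dg !scale0r !addr0 !subr0 => hE gE.
exists a, b; split=> //; rewrite mulrA -hE [x + a *: u + _]addrAC -gE.
by rewrite [x + s *: u + _]addrAC; ring.
Qed.

Lemma near_ball_close (R : realType) (V : normedModType R) (U : set V)
    (g h : V -> R) (x : V) (e : R) : open U -> U x ->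
  {for x, continuous g} -> {for x, continuous h} -> 0 < e ->
  exists2 r : R, 0 < r & forall y, ball x r y ->
    [/\ U y, `|g x - g y| <= e & `|h x - h y| <= e].
Proof.
move=> Uo Ux cg ch e0.
have Ux' : \forall y \near x, U y by exact: open_nbhs_nbhs.
have cg' : \forall y \near x, `|g x - g y| <= e.
  exact: (cvgrPdist_le _ _).1 cg _ e0.
have ch' : \forall y \near x, `|h x - h y| <= e.
  exact: (cvgrPdist_le _ _).1 ch _ e0.
suff /nbhs_ballP[r r0 rP] : \forall y \near x,
    [/\ U y, `|g x - g y| <= e & `|h x - h y| <= e] by exists r.
near=> y; split; near: y; assumption.
Unshelve. all: by end_near. Qed.

(* Both iterated derivatives are the limit of the same second difference
   quotient. *)
Lemma derive_swap (R : realType) (V : normedModType R) (U : set V) (f : V -> R)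
    (x u w : V) : open U -> U x ->
  (forall y, U y -> derivable f y u /\ derivable f y w) ->
  (forall y, U y -> derivable ('D_u f) y w /\ derivable ('D_w f) y u) ->
  {for x, continuous ('D_w ('D_u f))} -> {for x, continuous ('D_u ('D_w f))} ->
  'D_w ('D_u f) x = 'D_u ('D_w f) x.
Proof.
move=> Uo Ux df ddf cwu cuw; apply/eqP; rewrite -subr_eq0 -normr_le0.
apply/ler_addgt0Pr => e e0; rewrite add0r.
have e20 : 0 < e / 2 by rewrite divr_gt0.
have [r r0 rP] := near_ball_close Uo Ux cwu cuw e20.
(* With side scale [r / k] the whole parallelogram fits in the ball of radius [r]; the added 1 keeps
   [k] positive and the inclusion strict. *)
pose k := `|u| + `|w| + 1.
have k0 : 0 < k by rewrite ltr_wpDl// addr_ge0.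
pose s := r / k; have s0 : 0 < s by rewrite divr_gt0.
have ltW_ltW t : 0 < t < s -> 0 <= t <= s.
  by move=> /andP[t0 ts]; rewrite !ltW.
have B a b : 0 <= a <= s -> 0 <= b <= s -> ball x r (x + a *: u + b *: w).
  move=> /andP[a0 as_] /andP[b0 bs].
  rewrite -ball_normE/= -addrA opprD addNKr normrN.
  rewrite (le_lt_trans (ler_normD _ _))// !normrZ !ger0_norm//.
  apply: (@le_lt_trans _ _ (s * (`|u| + `|w|))).
    by rewrite mulrDr lerD// ler_wpM2r.
  by rewrite -[ltRHS](divfK (lt0r_neq0 k0)) ltr_pM2l// ltrDl.
have [a b a0 b0|a [b [/ltW_ltW a01 /ltW_ltW b01 E1]]] :=
    @second_difference _ _ f x u w s s0.
  have [Uy _ _] := rP _ (B _ _ a0 b0).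
  by split; [case: (df _ Uy)|case: (ddf _ Uy)].
have [b' a' b0' a0'|b' [a' [/ltW_ltW b01' /ltW_ltW a01' E2]]] :=
    @second_difference _ _ f x w u s s0.
  have [|Uy _ _] := rP (x + b' *: w + a' *: u).
    by rewrite addrAC; exact: B.
  by split; [case: (df _ Uy)|case: (ddf _ Uy)].
have E : 'D_w ('D_u f) (x + a *: u + b *: w) =
         'D_u ('D_w f) (x + b' *: w + a' *: u).
  have ss : s * s != 0 by rewrite mulf_neq0 ?gt_eqF.
  apply: (mulIf ss); apply: etrans (esym E1) (etrans _ E2).
  by rewrite [x + s *: u + _]addrAC; ring.
have [_ Ewu _] := rP _ (B a b a01 b01).
have [|_ _ Euw] := rP (x + b' *: w + a' *: u).
  by rewrite addrAC; apply: B.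
rewrite -E distrC in Euw; rewrite (splitr e).
exact: le_trans (ler_distD _ _ _) (lerD Ewu Euw).
Qed.

(** * The orthonormal frame of Sol *)

(* The orthonormal frame E_k = frame_coef k * d/dx_k of Sol satisfies
   nabla_{E_k} E_k = sol_weight k * E_2, nabla_{E_k} E_2 = - sol_weight k * E_k
   and nabla_{E_k} E_i = 0 otherwise. *)
Definition sol_weight (R : realType) (i : 'I_3) : R := [:: -1; 1; 0]`_i.

Definition frame_coef (R : realType) (i : 'I_3) (x : 'rV[R]_3) : R :=
  expR (sol_weight R i * x 0 2).

Definition frame_der (R : realType) (k : 'I_3) (f : 'rV[R]_3 -> R)
    (x : 'rV[R]_3) : R :=
  frame_coef k x * partial k f x.

(* The (k, i) entry is the i-th frame component of nabla_{E_k} u, where u has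
   frame components [u i]. *)
Definition covder (R : realType) (u : 'I_3 -> 'rV[R]_3 -> R) (x : 'rV[R]_3) :
    'M[R]_3 :=
  \matrix_(k, i) (frame_der k (u i) x -
    sol_weight R k * ((i == k)%:R * u 2 x - (i == 2)%:R * u k x)).

Lemma derive_translate (R : numFieldType) (V W : normedModType R) (f : V -> W)
    (a x v : V) : 'D_v (fun y => f (y + a)) x = 'D_v f (x + a).
Proof.
have E : (fun h : R => h^-1 *: (((fun y => f (y + a)) \o shift x) (h *: v)
                        - f (x + a))) =
         (fun h => h^-1 *: ((f \o shift (x + a)) (h *: v) - f (x + a))).
  by apply/funext => h /=; rewrite -addrA.
by rewrite /derive E.
Qed.

(** Near [x], [f] coincides with its translate by [t *: e], being constant along segments in
    direction [e]; hence all directional derivatives agree, whatever [w]. The neighbourhood is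
    shrunk so that these segments stay in the ball. *)
Lemma derive_translation_invariant (R : realType) (V : normedModType R)
    (f : V -> R) (e w x : V) (r t : R) :
  (forall y, ball x r y -> derivable f y e /\ 'D_e f y = 0) ->
  `|t| * `|e| < r -> 'D_w f (x + t *: e) = 'D_w f x.
Proof.
move=> fe tr; rewrite -derive_translate; apply: near_eq_derive.
near=> y.
have xy : `|x - y| < r - `|t| * `|e|.
  have : ball x (r - `|t| * `|e|) y.
    by near: y; apply: nbhsx_ballx; rewrite subr_gt0.
  by rewrite -ball_normE.
have line s : `|s| <= `|t| -> ball x r (y + s *: e).
  move=> st; rewrite -ball_normE/= opprD addrA.
  rewrite (le_lt_trans (ler_normB _ _))// normrZ.
  rewrite (@le_lt_trans _ _ (`|x - y| + `|t| * `|e|))//.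
    by rewrite lerD2l ler_wpM2r.
  by rewrite -ltrBrDr.
have dl (s : R) : `|s| <= `|t| -> is_derive s 1 (fun s => f (y + s *: e)) 0.
  by move=> /line/fe[d0 <-]; exact: is_derive_line.
have [t0|t0|->] := ltgtP t 0; last by rewrite scale0r addr0.
- have [s|c _] := @MVT_closed _ (fun s => f (y + s *: e)) (cst 0) t 0 t0.
    move=> /andP[ts s0]; apply: dl; rewrite !ler0_norm ?lerN2//.
    exact: ltW.
  by rewrite scale0r addr0 mul0r => /eqP; rewrite subr_eq0 => /eqP.
- have [s|c _] := @MVT_closed _ (fun s => f (y + s *: e)) (cst 0) 0 t t0.
    move=> /andP[s0 st]; apply: dl; rewrite !ger0_norm//.
    exact: ltW.
  by rewrite scale0r addr0 mul0r => /eqP; rewrite subr_eq0 => /eqP.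
Unshelve. all: by end_near. Qed.

Lemma is_diff_frame_coef (R : realType) (i : 'I_3) (x : 'rV[R]_3) :
  is_diff x (frame_coef i)
    (fun v => sol_weight R i * v 0 2 * frame_coef i x).
Proof.
pose l : 'rV[R]_3 -> R := fun v => v 0 2.
have lD : linear l by move=> a u v; rewrite /l !mxE.
pose l' : {linear 'rV[R]_3 -> R} :=
  HB.pack l (GRing.isLinear.Build R 'rV[R]_3 R _ l lD).
have lc : continuous l' by exact: coord_continuous.
have dl : is_diff x l l.
  split; first exact: (linear_differentiable x lc).
  exact: (diff_lin x lc).
pose c := sol_weight R i.
have de : is_diff (c * l x) (expR : R -> R) (fun h => h * expR (c * l x)).
  have [d1 d2] := is_derive_expR (c * l x).
  have d3 : differentiable (expR : R -> R) (c * l x) by exact/derivable1_diffP.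
  split=> //; apply/funext => h.
  by rewrite -[h in LHS]mulr1 -[h * 1]/(h *: (1 : R)) linearZ/= -deriveE// d2.
have dcl : is_diff x (c \*: l) (c \*: l) by exact: is_diffZ.
by apply: (is_diff_eq (is_diff_comp dcl de)); apply/funext.
Qed.

Lemma differentiable_frame_coef (R : realType) (i : 'I_3) (x : 'rV[R]_3) :
  differentiable (frame_coef i) x.
Proof. by have [] := is_diff_frame_coef i x. Qed.

Lemma partial_frame_coef (R : realType) (k i : 'I_3) (x : 'rV[R]_3) :
  partial k (frame_coef i) x = (k == 2)%:R * sol_weight R i * frame_coef i x.
Proof.
have [d dE] := is_diff_frame_coef i x; rewrite /partial deriveE// dE mxE eqxx/=.
by rewrite eq_sym [_ * sol_weight _ _]mulrC.
Qed.

(** * Unit Killing fields of Sol *)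

Lemma sum_ord3 (V : nmodType) (F : 'I_3 -> V) :
  \sum_i F i = F 0 + F 1 + F 2.
Proof.
rewrite !big_ord_recl big_ord0 addr0 addrA.
by congr (_ + F _ + F _); exact: val_inj.
Qed.

(** The three claims are the entries (0, 0), (2, 2) and (k, 2) of the Killing equation. The first
    carries the obstruction: moving along z stretches the x-direction. *)
Lemma covder_antisymmetricE (R : realType) (v : 'I_3 -> 'rV[R]_3 -> R)
    (x : 'rV[R]_3) : covder v x + (covder v x)^T = 0 ->
  [/\ partial 0 (v 0) x = 0 -> v 2 x = 0, partial 2 (v 2) x = 0 &
    forall k : 'I_3, k != 2 -> partial 2 (v k) x =
      - sol_weight R k * v k x - frame_coef k x * partial k (v 2) x].
Proof.
move=> vK; have E i j := congr1 (fun M : 'M[R]_3 => M i j) vK.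
have c2 : sol_weight R 2 = 0 by [].
have f2 : frame_coef 2 x = 1 by rewrite /frame_coef c2 mul0r expR0.
split.
- move: (E 0 0); rewrite !mxE/= /frame_der => + v0; rewrite v0.
  by rewrite /sol_weight/=; lra.
- by move: (E 2 2); rewrite !mxE/= /frame_der f2 c2; lra.
- move=> k k2; move: (E k 2); rewrite !mxE/= /frame_der f2 c2 (eq_sym 2 k).
  by rewrite (negbTE k2) /=; lra.
Qed.

(* Along the z-axis through x, a unit Killing field has v_2 constant and
   v_0'' = v_0, v_1'' = v_1, so differentiating |v|^2 = 1 twice gives
   v_0^2 + v_0'^2 + v_1^2 + v_1'^2 = 0. *)
Lemma unit_killing_components0 (R : realType) (U : set 'rV[R]_3)
    (v : 'I_3 -> 'rV[R]_3 -> R) (x : 'rV[R]_3) : open U -> U x ->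
  (forall y i, U y -> differentiable (v i) y) ->
  (forall y, U y -> \sum_i v i y ^+ 2 = 1) ->
  (forall y, U y -> covder v y + (covder v y)^T = 0) ->
  v 0 x = 0 /\ v 1 x = 0.
Proof.
move=> Uo Ux dv v1 vK.
have /nbhs_ballP[r /= r0 rU] : nbhs x U by exact: open_nbhs_nbhs.
pose e : 'rV[R]_3 := delta_mx 0 2.
have v2r y : ball x r y -> derivable (v 2) y e /\ 'D_e (v 2) y = 0.
  move=> /rU Uy; split; first exact/diff_derivable/dv.
  by have [_ ] := covder_antisymmetricE (vK _ Uy).
pose r' := r / (`|e| + 1).
have e1 : 0 < `|e| + 1 by rewrite ltr_wpDl.
have r'0 : 0 < r' by rewrite divr_gt0.
have te (t : R) : `|t| < r' -> `|t| * `|e| < r.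
  rewrite ltr_pdivlMr// => tr; apply: le_lt_trans tr.
  by rewrite ler_wpM2l// lerDl.
have Ut (t : R) : `|t| < r' -> U (x + t *: e).
  move=> /te tr; apply: rU; rewrite -ball_normE/= opprD addNKr normrN.
  by rewrite normrZ.
pose g i (t : R) := v i (x + t *: e).
pose E i (t : R) := frame_coef i (x + t *: e).
pose b i := partial i (v 2) x.
(* The Killing equation gives this as the derivative of [g i], with the transverse derivative of
   [v 2] frozen at its value [b i] at [x]. Only [g i] and an exponential remain, so it can be
   differentiated once more. *)
pose dg i : R -> R := (- sol_weight R i) \*: g i - b i \*: E i.
have dgE i t : dg i t = - sol_weight R i * g i t - b i * E i t by [].
have gE i (t : R) : i != 2 -> `|t| < r' -> is_derive t 1 (g i) (dg i t).
  move=> i2 tr; have Uy := Ut _ tr.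
  have [_ _ /(_ _ i2)] := covder_antisymmetricE (vK _ Uy).
  rewrite [partial i (v 2) _](derive_translation_invariant _ v2r (te _ tr)).
  rewrite dgE [b i * _]mulrC => <-.
  exact/is_derive_line/diff_derivable/dv.
have g2E (t : R) : `|t| < r' -> is_derive t 1 (g 2) 0.
  move=> tr; have Uy := Ut _ tr.
  have [_ <- _] := covder_antisymmetricE (vK _ Uy).
  exact/is_derive_line/diff_derivable/dv.
have EE i (t : R) : is_derive t 1 (E i) (sol_weight R i * E i t).
  have := @is_derive_line _ _ _ (frame_coef i) x e t.
  rewrite -[X in is_derive _ _ _ X]/(partial 2 (frame_coef i) _).
  rewrite partial_frame_coef mul1r; apply.
  exact/diff_derivable/differentiable_frame_coef.
have near_r' (t : R) : `|t| < r' -> \forall s \near t, `|s| < r'.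
  move=> tr; have : \forall s \near t, ball (0 : R) r' s.
    apply: open_nbhs_nbhs; split; first exact: ball_open.
    by rewrite -ball_normE/= sub0r normrN.
  by apply: filterS => s; rewrite -ball_normE/= sub0r normrN.
pose psi : R -> R := g 0 * g 0 + g 1 * g 1 + g 2 * g 2.
(* Half the derivative of [psi]; [g 2] contributes nothing, having derivative zero. *)
pose phi : R -> R := g 0 * dg 0 + g 1 * dg 1.
have phi0 (t : R) : `|t| < r' -> phi t = 0.
  move=> tr.
  have [d0 d1 d2] := And3 (gE 0 t isT tr) (gE 1 t isT tr) (g2E t tr).
  have [_ psiE] := is_deriveD (is_deriveD (is_deriveM d0 d0) (is_deriveM d1 d1))
    (is_deriveM d2 d2).
  have : 'D_1 psi t = 0.
    rewrite (near_eq_derive (g := (cst 1 : R -> R))) ?derive_cst//.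
    apply: filterS (near_r' t tr) => s /Ut/v1.
    by rewrite sum_ord3 !expr2.
  rewrite psiE /phi => psi0; apply: (mulfI (x := 2)) => //.
  by rewrite mulr0 -[RHS]psi0 /GRing.scale/= !fctE; ring.
(* The two terms in [b i] cancel, since [E i] has logarithmic derivative [sol_weight R i]. The
   squared weight is 1 for both remaining indices. *)
have dgd i : i != 2 -> is_derive (0 : R) 1 (dg i) (sol_weight R i ^+ 2 * g i 0).
  move=> i2; have d0 := gE i 0 i2 (eq_ind_r (fun z => z < r') r'0 (normr0 _)).
  have := is_deriveB (is_deriveZ (- sol_weight R i) d0) (is_deriveZ (b i) (EE i 0)).
  by move/is_derive_eq; apply; rewrite dgE /GRing.scale/=; ring.
have tr0 : `|0 : R| < r' by rewrite normr0.
have [_ phiE] := is_deriveD (is_deriveM (gE 0 0 isT tr0) (dgd 0 isT))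
  (is_deriveM (gE 1 0 isT tr0) (dgd 1 isT)).
have : 'D_1 phi (0 : R) = 0.
  rewrite (near_eq_derive (g := (cst 0 : R -> R))) ?derive_cst//.
  by apply: filterS (near_r' 0 tr0) => s /phi0.
have gx i : g i 0 = v i x by rewrite /g scale0r addr0.
rewrite phiE /GRing.scale/= !gx /sol_weight/= sqrrN expr1n !mul1r => sumsq.
 have := sqr_ge0 (dg 0 0); have := sqr_ge0 (dg 1 0).
have := sqr_ge0 (v 0 x); have := sqr_ge0 (v 1 x); rewrite !expr2 => *.
by split; apply/eqP; rewrite -sqrf_eq0 eq_le sqr_ge0 andbT expr2; lra.
Qed.

Lemma no_unit_killing_field (R : realType) (U : set 'rV[R]_3)
    (v : 'I_3 -> 'rV[R]_3 -> R) (x : 'rV[R]_3) : open U -> U x ->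
  (forall y i, U y -> differentiable (v i) y) ->
  (forall y, U y -> \sum_i v i y ^+ 2 = 1) ->
  (forall y, U y -> covder v y + (covder v y)^T = 0) ->
  False.
Proof.
move=> Uo Ux dv v1 vK.
have v0 y (Uy : U y) := unit_killing_components0 Uo Uy dv v1 vK.
have [v2 _ _] := covder_antisymmetricE (vK _ Ux).
(* This takes the vanishing of [v 0] on all of [U], hence the previous lemma at every point and not
   only at [x]. *)
have d0 : partial 0 (v 0) x = 0.
  rewrite /partial (near_eq_derive (g := (cst 0 : 'rV[R]_3 -> R))) ?derive_cst//.
  have : \forall y \near x, U y by exact: open_nbhs_nbhs.
  by apply: filterS => y /v0[].
have [v0x v1x] := v0 _ Ux.
have := v1 _ Ux; rewrite sum_ord3.
by rewrite v0x v1x v2// expr2; lra.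
Qed.

(** * Hessians in the frame *)

Lemma open_near_eq (T : topologicalType) (V : Type) (U : set T)
    (f g : T -> V) (x : T) : open U -> U x -> {in U, f =1 g} ->
  \forall y \near x, f y = g y.
Proof.
move=> Uo Ux fg; have : \forall y \near x, U y by exact: open_nbhs_nbhs.
by apply: filterS => y Uy; apply: fg; rewrite inE.
Qed.

Lemma partial_eq_on (R : realType) (n : nat) (V : normedModType R)
    (U : set 'rV[R]_n) (f g : 'rV[R]_n -> V) (i : 'I_n) : open U ->
  {in U, f =1 g} -> {in U, partial i f =1 partial i g}.
Proof.
move=> Uo fg x /[!inE] Ux.
by apply: near_eq_derive; exact: open_near_eq Ux fg.
Qed.

Lemma near0_differentiable (R : numFieldType) (V W : normedModType R)
    (f : V -> W) (x : V) : (\forall y \near x, f y = 0) -> differentiable f x.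
Proof.
move=> f0; have fx : f x = 0 by exact: nbhs_singleton f0.
have E : f \o shift x = cst (f x) + (\0 : {linear V -> W}) +o_ 0 id.
  apply/eqaddoP => _/posnumP[e]; rewrite -nbhs_nearE.
  have : \forall h \near 0, f (h + x) = 0.
    by move: f0; rewrite [X in X -> _](near_shift 0) subr0.
  apply: filterS => h /= fhx.
  by rewrite !fctE/= fhx fx addr0 subrr normr0 mulr_ge0.
have c0 : continuous (\0 : {linear V -> W}) by move=> y; exact: cst_continuous.
by apply/diff_locallyP; rewrite (diff_unique c0 E).
Qed.

Lemma near_eq_differentiable (R : numFieldType) (V W : normedModType R)
    (f g : V -> W) (x : V) : (\forall y \near x, f y = g y) ->
  differentiable f x -> differentiable g x.
Proof.
move=> fg df; rewrite -[g](subKr f); apply: differentiableB => //.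
apply: near0_differentiable; apply: filterS fg => y fgy.
by rewrite !fctE fgy subrr.
Qed.

Lemma ck_on_eq (R : realType) (n : nat) (V : normedModType R) (k : nat)
    (U : set 'rV[R]_n) (f g : 'rV[R]_n -> V) : open U ->
  {in U, f =1 g} -> ck_on k U f -> ck_on k U g.
Proof.
move=> Uo; elim: k f g => [|k IH] f g fg /=.
  move=> cf x Ux; have fgx := open_near_eq Uo Ux fg.
  rewrite /prop_for /continuous_at -(fg x) ?inE//.
  exact: cvg_trans (near_eq_cvg fgx) (cf x Ux).
move=> [df dkf]; split=> [x Ux|i].
  have fgx := open_near_eq Uo Ux fg.
  exact: near_eq_differentiable fgx (df x Ux).
by apply: IH (dkf i); exact: partial_eq_on.
Qed.

Lemma ck_on_entry (R : realType) (n p q : nat) (k : nat) (U : set 'rV[R]_n)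
    (f : 'rV[R]_n -> 'M[R]_(p, q)) (i : 'I_p) (j : 'I_q) : open U ->
  ck_on k U f -> ck_on k U (fun x => f x i j).
Proof.
move=> Uo; elim: k f => [|k IH] f /=.
  move=> cf x Ux; apply: (@continuous_comp _ _ _ f (fun M : 'M[R]_(p, q) => M i j)).
    exact: cf.
  exact: coord_continuous.
move=> [df dkf]; split=> [x Ux|l].
  exact: (differentiable_comp (df x Ux) (differentiable_coord _ i j)).
(* Taking an entry commutes with [partial] where [f] is differentiable, so the two functions are
   compared on [U] only. *)
apply: ck_on_eq Uo _ (IH _ (dkf l)) => x /[!inE] Ux.
by rewrite /partial derive_mx ?mxE//; exact/diff_derivable/df.
Qed.

Lemma frame_derM (R : realType) (k : 'I_3) (f g : 'rV[R]_3 -> R) x :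
  differentiable f x -> differentiable g x ->
  frame_der k (f * g) x = frame_der k f x * g x + f x * frame_der k g x.
Proof.
move=> df dg; rewrite /frame_der /partial deriveM; try exact: diff_derivable.
by rewrite /GRing.scale/=; ring.
Qed.

Lemma ord3_ind (P : 'I_3 -> Prop) : P 0 -> P 1 -> P 2 -> forall i, P i.
Proof.
move=> P0 P1 P2; case=> [[|[|[|//]]] i3].
- by rewrite (_ : Ordinal i3 = 0)//; exact: val_inj.
- by rewrite (_ : Ordinal i3 = 1)//; exact: val_inj.
- by rewrite (_ : Ordinal i3 = 2)//; exact: val_inj.
Qed.

(** The connection terms of [covder] are skew in the component indices, so they cancel in the sum:
    the connection is metric. *)
Lemma covder_metric (R : realType) (u w : 'I_3 -> 'rV[R]_3 -> R) (x : 'rV[R]_3)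
    (k : 'I_3) :
  (forall i, differentiable (u i) x) -> (forall i, differentiable (w i) x) ->
  frame_der k (fun y => \sum_i u i y * w i y) x =
  \sum_i (covder u x k i * w i x + u i x * covder w x k i).
Proof.
move=> du dw.
have -> : (fun y => \sum_i u i y * w i y) = \sum_i (u i * w i).
  by apply/funext => y; rewrite fct_sumE.
have -> : frame_der k (\sum_i (u i * w i)) x = \sum_i frame_der k (u i * w i) x.
  rewrite /frame_der /partial derive_sum ?mulr_sumr// => i.
  by apply: derivableM; exact: diff_derivable.
rewrite !sum_ord3 !frame_derM// !mxE.
by elim/ord3_ind: k => /=; ring.
Qed.

(** The first-order terms come from differentiating [frame_coef i] and from the connection. Grouped
    this way they are visibly symmetric in [k] and [i], which reduces the symmetry of the Hessian to
    that of second partials. *)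
Lemma hessianE (R : realType) (f : 'rV[R]_3 -> R) (x : 'rV[R]_3) (k i : 'I_3) :
  (forall j, differentiable (partial j f) x) ->
  covder (fun j => frame_der j f) x k i =
  frame_coef k x * frame_coef i x * partial k (partial i f) x +
  ((k == 2)%:R * sol_weight R i * frame_der i f x +
   (i == 2)%:R * sol_weight R k * frame_der k f x) -
  sol_weight R k * (i == k)%:R * frame_der 2 f x.
Proof.
move=> df; rewrite mxE.
have -> : frame_der i f = frame_coef i * partial i f by [].
rewrite frame_derM//; last exact: differentiable_frame_coef.
rewrite {1}/frame_der partial_frame_coef /frame_der !fctE.
have f2 : frame_coef 2 x = 1 by rewrite /frame_coef mul0r expR0.
by have [->|_] := eqVneq k 2; rewrite ?f2 /=; ring.
Qed.

Lemma hessian_sym (R : realType) (U : set 'rV[R]_3) (f : 'rV[R]_3 -> R)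
    (x : 'rV[R]_3) : open U -> U x -> ck_on 2 U f ->
  (covder (fun j => frame_der j f) x)^T = covder (fun j => frame_der j f) x.
Proof.
move=> Uo Ux [df d2f]; have d1 j : differentiable (partial j f) x.
  by have [+ _] := d2f j; exact.
have sym k i : partial k (partial i f) x = partial i (partial k f) x.
  apply: (derive_swap Uo Ux).
  - by move=> y Uy; split; exact/diff_derivable/df.
  - move=> y Uy; split; apply: diff_derivable.
      by have [+ _] := d2f i; exact.
    by have [+ _] := d2f k; exact.
  - by have [_ +] := d2f i; move=> /(_ k); exact.
  - by have [_ +] := d2f k; move=> /(_ i); exact.
apply/matrixP => i k; rewrite mxE !hessianE// [partial k _ _]sym.
have [->|ik] := eqVneq i k; first by ring.
by rewrite /=; ring.
Qed.

(** The first-order terms drop out because the weights -1, 1, 0 sum to zero. *)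
Lemma hessian_trace (R : realType) (f : 'rV[R]_3 -> R) (x : 'rV[R]_3) :
  (forall j, differentiable (partial j f) x) ->
  \tr (covder (fun j => frame_der j f) x) =
  \sum_i frame_coef i x ^+ 2 * partial i (partial i f) x.
Proof.
move=> df; have w0 : \sum_i sol_weight R i = 0.
  by rewrite sum_ord3 /sol_weight/= addNr addr0.
transitivity (\sum_i (frame_coef i x ^+ 2 * partial i (partial i f) x -
                      sol_weight R i * frame_der 2 f x)).
  apply: eq_bigr => i _; rewrite hessianE//.
  have -> : (i == 2)%:R * sol_weight R i = 0.
    by have [->|_] := eqVneq i 2; rewrite ?mul0r// mulr0.
  by rewrite mul0r addr0 addr0 eqxx mulr1 expr2.
by rewrite sumrB -mulr_suml w0 mul0r subr0.
Qed.

(** * Metrics along a submersion *)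

Lemma partial_entry (R : realType) (m p q : nat) (M : 'rV[R]_m -> 'M[R]_(p, q))
    (x : 'rV[R]_m) (k : 'I_m) (i : 'I_p) (j : 'I_q) :
  differentiable M x -> partial k M x i j = partial k (fun y => M y i j) x.
Proof.
by move=> dM; rewrite /partial derive_mx ?mxE//; exact: diff_derivable.
Qed.

Lemma partial_comp (R : realType) (m n : nat) (F : 'rV[R]_m -> 'rV[R]_n)
    (h : 'rV[R]_n -> R) (x : 'rV[R]_m) (k : 'I_m) :
  differentiable F x -> differentiable h (F x) ->
  partial k (h \o F) x =
  \sum_c partial c h (F x) * partial k (fun y => F y 0 c) x.
Proof.
move=> dF dh; rewrite {1}/partial deriveE; last exact: differentiable_comp.
rewrite diff_comp//= -(deriveE _ dF) (row_sum_delta ('D_ _ F x)) linear_sum.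
apply: eq_bigr => c _; rewrite linearZ/= -deriveE// -partial_entry//.
by rewrite [LHS]mulrC.
Qed.

Definition frame_der_mx (R : realType) (p q : nat) (k : 'I_3)
    (M : 'rV[R]_3 -> 'M[R]_(p, q)) (x : 'rV[R]_3) : 'M[R]_(p, q) :=
  \matrix_(i, j) frame_der k (fun y => M y i j) x.

Lemma frame_der_sum (R : realType) (n : nat) (k : 'I_3)
    (f : 'I_n -> 'rV[R]_3 -> R) (x : 'rV[R]_3) :
  (forall i, differentiable (f i) x) ->
  frame_der k (fun y => \sum_i f i y) x = \sum_i frame_der k (f i) x.
Proof.
move=> df; have -> : (fun y => \sum_i f i y) = \sum_i f i.
  by apply/funext => y; rewrite fct_sumE.
rewrite /frame_der /partial derive_sum ?mulr_sumr// => i.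
exact: diff_derivable.
Qed.

Lemma frame_der_mulmx (R : realType) (p q r : nat) (k : 'I_3)
    (M : 'rV[R]_3 -> 'M[R]_(p, q)) (N : 'rV[R]_3 -> 'M[R]_(q, r)) x :
  (forall i j, differentiable (fun y => M y i j) x) ->
  (forall i j, differentiable (fun y => N y i j) x) ->
  frame_der_mx k (fun y => M y *m N y) x =
  frame_der_mx k M x *m N x + M x *m frame_der_mx k N x.
Proof.
move=> dM dN; apply/matrixP => i j; rewrite !mxE -big_split/=.
under [X in frame_der k X]eq_fun do rewrite mxE.
rewrite frame_der_sum => [|l]; last exact: differentiableM.
by apply: eq_bigr => l _; rewrite !mxE frame_derM.
Qed.

Lemma frame_der_inverse (R : realType) (n : nat) (k : 'I_3) (U : set 'rV[R]_3)
    (M N : 'rV[R]_3 -> 'M[R]_n) x : open U -> U x ->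
  (forall i j, differentiable (fun y => M y i j) x) ->
  (forall i j, differentiable (fun y => N y i j) x) ->
  (forall y, U y -> M y *m N y = 1%:M) ->
  frame_der_mx k M x = - (M x *m frame_der_mx k N x *m M x).
Proof.
move=> Uo Ux dM dN MN; have NM := mulmx1C (MN _ Ux).
have E : frame_der_mx k (fun y => M y *m N y) x = 0.
  apply/matrixP => i j; rewrite !mxE /frame_der /partial.
  rewrite (near_eq_derive (g := (cst ((1%:M : 'M[R]_n) i j) : 'rV[R]_3 -> R))).
    by rewrite derive_cst mulr0.
  by apply: (open_near_eq Uo Ux) => y /[!inE] Uy; rewrite MN.
rewrite -[LHS]mulmx1 -NM mulmxA -mulNmx; congr (_ *m _).
by apply/eqP; rewrite -addr_eq0 -frame_der_mulmx// E.
Qed.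

Lemma inner_row (R : realType) (m n : nat) (G : 'M[R]_n) (M : 'M[R]_(m, n)) a b :
  inner G (row a M) (row b M) = (M *m G *m M^T) a b.
Proof.
rewrite /inner -row_mul mxE [RHS]mxE; apply: eq_bigr => i _.
by rewrite [in LHS]mxE tr_row !mxE.
Qed.

(** Tested on gradients, the isometry condition reads K H K = K with K = [J^T *m Q *m J]. Full rank
    of [J] and positivity of [G] make K invertible, so one factor cancels. *)
Lemma submersion_dual_metric (R : realType) (m n : nat) (G Q : 'M[R]_m)
    (J : 'M[R]_(m, n)) (H : 'M[R]_n) :
  G^T = G -> (forall u, u != 0 -> 0 < inner G u u) -> G *m Q = 1%:M ->
  row_full J ->
  (forall u v, horizontal G J u -> horizontal G J v ->
    inner H (u *m J) (v *m J) = inner G u v) ->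
  J^T *m Q *m J *m H = 1%:M.
Proof.
move=> GT Gpos GQ Jfull Hsub; have QG := mulmx1C GQ.
have QT : Q^T = Q.
  by rewrite -[LHS]mulmx1 -GQ mulmxA -{1}GT -trmx_mul GQ trmx1 mul1mx.
set K := J^T *m Q *m J.
have KT : K^T = K by rewrite /K !trmx_mul trmxK QT mulmxA.
(* This vector is the gradient of the combination [w] of the components of the map, hence orthogonal
   to the kernel of [J]. *)
have hor w : horizontal G J (w *m J^T *m Q).
  move=> z zJ; rewrite /inner -!mulmxA [Q *m _]mulmxA QG mul1mx -trmx_mul zJ.
  by rewrite trmx0 mulmx0 mxE.
have iG w z : inner G (w *m J^T *m Q) (z *m J^T *m Q) = inner K w z.
  rewrite /inner !trmx_mul !trmxK QT -!mulmxA [Q *m (G *m _)]mulmxA QG mul1mx.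
  by rewrite /K !mulmxA.
have KHK : K *m H *m K = K.
  apply/matrixP => a b.
  have e i : row i 1%:M *m J^T *m Q *m J = row i K by rewrite -!row_mul !mul1mx.
  have := Hsub _ _ (hor (row a 1%:M)) (hor (row b 1%:M)).
  by rewrite iG !e !inner_row KT trmx1 mul1mx mulmx1.
have Kfree : row_free K.
  apply: inj_row_free => w wK; pose y := w *m J^T *m Q.
  have y0 : y = 0.
    apply/eqP/negPn/negP => /Gpos; rewrite iG /inner wK mul0mx mxE ltxx//.
  have wJ : w *m J^T = 0 by rewrite -[LHS]mulmx1 -QG mulmxA [_ *m Q]y0 mul0mx.
  have /row_fullP[B BJ] := Jfull.
  by rewrite -[w]mulmx1 -trmx1 -BJ trmx_mul mulmxA wJ mul0mx.
have Ku : K \in unitmx by rewrite -row_free_unit.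
by rewrite -[LHS]mulmx1 -(mulmxV Ku) mulmxA KHK mulmxV.
Qed.

(** * The unit vertical field *)

Lemma det_mx22 (R : comPzRingType) (A : 'M[R]_2) :
  \det A = A 0 0 * A 1 1 - A 0 1 * A 1 0.
Proof.
rewrite (expand_det_row _ 0) !big_ord_recl big_ord0 addr0 /cofactor !det_mx11.
rewrite !mxE /= expr0 expr1 mul1r mulN1r mulrN.
by congr (A _ _ * A _ _ - A _ _ * A _ _); exact: val_inj.
Qed.

(** By Lagrange's identity the Gram determinant of the two rows is the squared length of their cross
    product. The latter thus never vanishes on [U], and normalizing it gives one differentiable
    field on all of [U]. *)
Lemma exists_unit_normal (R : realType) (U : set 'rV[R]_3)
    (P : 'rV[R]_3 -> 'M[R]_(2, 3)) :
  (forall y a i, U y -> differentiable (fun z => P z a i) y) ->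
  (forall y, U y -> \det (P y *m (P y)^T) != 0) ->
  exists v : 'I_3 -> 'rV[R]_3 -> R,
    [/\ forall y i, U y -> differentiable (v i) y,
        forall y, U y -> \sum_i v i y ^+ 2 = 1 &
        forall y a, U y -> \sum_i P y a i * v i y = 0].
Proof.
move=> dP detP.
(* W is the cross product of the two rows of P, and D = |W|^2. *)
pose m i j : 'rV[R]_3 -> R :=
  (fun z => P z 0 i) * (fun z => P z 1 j) -
  (fun z => P z 0 j) * (fun z => P z 1 i).
pose W (i : 'I_3) : 'rV[R]_3 -> R := nth 0 [:: m 1 2; m 2 0; m 0 1] i.
pose D : 'rV[R]_3 -> R := W 0 * W 0 + W 1 * W 1 + W 2 * W 2.
have dm i j y : U y -> differentiable (m i j) y.
  by move=> Uy; apply: differentiableB; apply: differentiableM; exact: dP.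
have dW i y : U y -> differentiable (W i) y.
  by move=> Uy; elim/ord3_ind: i; exact: dm.
have dD y : U y -> differentiable D y.
  move=> Uy; apply: differentiableD; last by apply: differentiableM; exact: dW.
  by apply: differentiableD; apply: differentiableM; exact: dW.
have WE y : [/\ W 0 y = P y 0 1 * P y 1 2 - P y 0 2 * P y 1 1,
    W 1 y = P y 0 2 * P y 1 0 - P y 0 0 * P y 1 2 &
    W 2 y = P y 0 0 * P y 1 1 - P y 0 1 * P y 1 0] by [].
have DE y : D y = W 0 y * W 0 y + W 1 y * W 1 y + W 2 y * W 2 y by [].
have detD y : \det (P y *m (P y)^T) = D y.
  rewrite det_mx22 !mxE !sum_ord3 !mxE DE; have [-> -> ->] := WE y; ring.
have D0 y : U y -> 0 < D y.
  move=> /detP; rewrite detD lt0r => ->; rewrite DE -!expr2.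
  by rewrite !addr_ge0// sqr_ge0.
pose s : 'rV[R]_3 -> R := fun z => (Num.sqrt (D z))^-1.
have ds y : U y -> differentiable s y.
  move=> Uy; apply: differentiableV; last by rewrite gt_eqF// sqrtr_gt0 D0.
  apply: (differentiable_comp (dD _ Uy)); apply/derivable1_diffP.
  by have [] := is_derive1_sqrt (D0 _ Uy).
exists (fun i => W i * s); split.
- by move=> y i Uy; apply: differentiableM; [exact: dW|exact: ds].
- move=> y Uy; rewrite sum_ord3 /= !fctE !exprMn -!mulrDl !expr2 -DE.
  rewrite -expr2 exprVn sqr_sqrtr ?ltW ?D0// mulfV// gt_eqF// D0//.
- move=> y a Uy; rewrite sum_ord3 /= !fctE; have [-> -> ->] := WE y.
  case: a => [[|[|//]] a2].
    by rewrite (_ : Ordinal a2 = 0); [ring | exact: val_inj].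
  by rewrite (_ : Ordinal a2 = 1); [ring | exact: val_inj].
Qed.

(** Rows are indexed by the target, the transpose of the convention of ['J], so that the product
    with its own transpose is the Gram matrix of the gradients. *)
Definition frame_jacobian (R : realType) (n : nat) (F : 'rV[R]_3 -> 'rV[R]_n)
    (x : 'rV[R]_3) : 'M[R]_(n, 3) :=
  \matrix_(a, i) frame_der i (fun y => F y 0 a) x.

Lemma differentiable_frame_jacobian (R : realType) (n : nat) (U : set 'rV[R]_3)
    (F : 'rV[R]_3 -> 'rV[R]_n) y a i : open U -> ck_on 2 U F -> U y ->
  differentiable (fun t => frame_jacobian F t a i) y.
Proof.
move=> Uo CF Uy; under eq_fun do rewrite mxE.
have [_ /(_ i)[+ _]] := @ck_on_entry _ _ _ _ 2 U F 0 a Uo CF.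
move=> /(_ y Uy); apply: differentiableM.
exact: differentiable_frame_coef.
Qed.

(** The pointwise hypotheses of [antisymmetric_of_tension] arise by differentiating identities valid
    on the open set [U]: unit length, orthogonality to the gradients, and the Gram matrix being
    inverse to the target metric. *)
Lemma unit_normal_killing (R : realType) (U : set 'rV[R]_3) (V : set 'rV[R]_2)
    (F : 'rV[R]_3 -> 'rV[R]_2) (H : 'rV[R]_2 -> 'M[R]_2)
    (v : 'I_3 -> 'rV[R]_3 -> R) (x : 'rV[R]_3) :
  let P := frame_jacobian F in
  open U -> open V -> (forall y, U y -> V (F y)) -> ck_on 2 U F ->
  (forall z b c, V z -> differentiable (fun t => H t b c) z) ->
  (forall z, V z -> (H z)^T = H z) ->
  (forall y, U y -> P y *m (P y)^T *m H (F y) = 1%:M) ->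
  (forall y a, U y ->
    \sum_i frame_coef i y ^+ 2 * partial i (partial i (fun t => F t 0 a)) y +
    \sum_b \sum_c christoffel H a b c (F y) * (P y *m (P y)^T) b c = 0) ->
  (forall y i, U y -> differentiable (v i) y) ->
  (forall y, U y -> \sum_i v i y ^+ 2 = 1) ->
  (forall y a, U y -> \sum_i P y a i * v i y = 0) ->
  U x -> covder v x + (covder v x)^T = 0.
Proof.
move=> P Uo Vo UV CF dH HT PPH tau dv v1 Pv Ux.
have Cf a : ck_on 2 U (fun y => F y 0 a) by exact: ck_on_entry.
have dpart a i y : U y -> differentiable (partial i (fun t => F t 0 a)) y.
  by move=> Uy; have [_ /(_ i)[+ _]] := Cf a; exact.
have dp a i y : U y -> differentiable (frame_der i (fun t => F t 0 a)) y.
  move=> Uy; apply: differentiableM; last exact: dpart.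
  exact: differentiable_frame_coef.
have dF y : U y -> differentiable F y by have [+ _] := CF; exact.
pose p a i := frame_der i (fun t => F t 0 a).
have PE y a i : P y a i = p a i y by rewrite mxE.
pose D c : 'M[R]_2 := \matrix_(b, e) partial c (fun t => H t b e) (F x).
pose A a := covder (p a) x.
have AT a : (A a)^T = A a by exact: (hessian_sym Uo Ux (Cf a)).
have Dp0 k (f : 'rV[R]_3 -> R) c : (forall y, U y -> f y = c) ->
    frame_der k f x = 0.
  move=> fc; rewrite /frame_der /partial.
  rewrite (near_eq_derive (g := (cst c : 'rV[R]_3 -> R))) ?derive_cst ?mulr0//.
  by apply: (open_near_eq Uo Ux) => y /[!inE]; exact: fc.
apply: (@antisymmetric_of_tension R 2 (P x) (H (F x)) D A (\row_i v i x)).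
- exact: PPH.
- apply/matrixP => a j; rewrite !mxE -[RHS](Pv x a Ux); apply: eq_bigr => i _.
  by rewrite [(_^T) _ _]mxE [(\row__ _) _ _]mxE.
- apply/matrixP => i j; rewrite !ord1 mxE [RHS]mxE eqxx -[RHS](v1 x Ux).
  by apply: eq_bigr => l _; rewrite !mxE expr2.
- move=> c; apply/matrixP => b e; rewrite !mxE; apply: near_eq_derive.
  apply: (open_near_eq Vo (UV _ Ux)) => z /[!inE] Vz.
  by rewrite -[in LHS](HT z Vz) mxE.
- exact: AT.
- move=> a b; apply/rowP => k.
  (* Metric compatibility and the symmetry of the Hessians turn the left side into a derivative of
     the Gram matrix. *)
  have E1 : (row a (P x) *m A b + row b (P x) *m A a) 0 k =
      frame_der_mx k (fun y => P y *m (P y)^T) x a b.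
    rewrite [RHS]mxE; under [X in frame_der k X]eq_fun do rewrite mxE.
    under [X in frame_der k X]eq_fun do
      (under eq_bigr do rewrite [(_^T) _ _]mxE !PE).
    rewrite covder_metric; [|by move=> i; exact: dp|by move=> i; exact: dp].
    rewrite big_split/= addrC mxE; congr (_ + _); rewrite mxE;
      apply: eq_bigr => i _; rewrite [row _ _ _ _]mxE PE.
      by rewrite -[in LHS](AT b) mxE.
    by rewrite -[in LHS](AT a) mxE mulrC.
  have dK i j : differentiable (fun y => (P y *m (P y)^T) i j) x.
    have -> : (fun y => (P y *m (P y)^T) i j) = \sum_l (p i l * p j l).
      apply/funext => y; rewrite mxE fct_sumE; apply: eq_bigr => l _.
      by rewrite [(_^T) _ _]mxE !PE.
    by apply: differentiable_sum => l; apply: differentiableM; exact: dp.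
  have dHF i j : differentiable (fun y => H (F y) i j) x.
    exact: (differentiable_comp (dF _ Ux) (dH _ _ _ (UV _ Ux))).
  rewrite E1 (frame_der_inverse (N := H \o F) k Uo Ux dK dHF PPH).
  have -> : frame_der_mx k (H \o F) x = \sum_c P x c k *: D c.
    apply/matrixP => i j; rewrite mxE summxE /frame_der.
    rewrite [partial k _ x](partial_comp k (dF _ Ux) (dH _ i j (UV _ Ux))).
    rewrite mulr_sumr; apply: eq_bigr => c _.
    by rewrite [RHS]mxE PE [D _ _ _]mxE mulrCA mulrC.
  rewrite mulmx_sumr mulmx_suml [LHS]mxE [RHS]mxE; congr (- _).
  rewrite [LHS]summxE [RHS]summxE; apply: eq_bigr => c _.
  by rewrite -scalemxAr -scalemxAl [LHS]mxE [RHS]mxE [row _ _ _ _]mxE mulrC.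
- move=> a; rewrite -[RHS](tau x a Ux) hessian_trace; last first.
    by move=> j; exact: dpart.
  congr (_ + _); apply: eq_bigr => b _; apply: eq_bigr => c _.
  rewrite /christoffel; have -> : invmx (H (F x)) = P x *m (P x)^T.
    have KH := PPH _ Ux; have [_ Hu] := mulmx1_unit KH.
    by rewrite -[LHS]mul1mx -KH mulmxK.
  congr (_ * _ * _); apply: eq_bigr => l _.
  by congr (_ * _); rewrite [D b _ _]mxE [D c _ _]mxE [D l _ _]mxE.
- apply/matrixP => k j; rewrite !ord1 [RHS]mxE mxE.
  have := covder_metric k (fun i => dv _ i Ux) (fun i => dv _ i Ux).
  rewrite (Dp0 k _ 1) => [|y Uy]; last first.
    by rewrite -[RHS](v1 _ Uy); apply: eq_bigr => i _; rewrite expr2.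
  rewrite big_split/= => E0; apply: (mulfI (x := 2)) => //.
  rewrite mulr0 [RHS]E0 mulr_natl mulr2n; congr (_ + _); apply: eq_bigr => i _.
    by rewrite [(_^T) _ _]mxE [(\row__ _) _ _]mxE.
  by rewrite [(_^T) _ _]mxE [(\row__ _) _ _]mxE mulrC.
- move=> a; apply/eqP; rewrite -addr_eq0; apply/eqP.
  apply/matrixP => k j; rewrite !ord1 [RHS]mxE.
  have := covder_metric k (fun i => dv _ i Ux) (fun i => dp a i x Ux).
  rewrite (Dp0 k _ 0) => [->|y Uy]; last first.
    by rewrite -[RHS](Pv _ a Uy); apply: eq_bigr => i _; rewrite PE mulrC.
  rewrite big_split/= mxE; congr (_ + _); rewrite mxE; apply: eq_bigr => i _.
    by rewrite tr_row [col _ _ _ _]mxE [(_^T) _ _]mxE PE.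
  by rewrite [(_^T) _ _]mxE [(\row__ _) _ _]mxE mulrC.
Qed.

(** * Tension in Sol coordinates *)

Lemma sol_metric_frame_coef (R : realType) (x : 'rV[R]_3) (i : 'I_3) :
  sol_metric x i i * frame_coef i x ^+ 2 = 1.
Proof.
rewrite /sol_metric mxE eqxx mulr1n mxE /frame_coef /sol_weight expr2 -!expRD.
elim/ord3_ind: i => /=; rewrite -?expRD; last by rewrite !mul0r addr0 expR0 mulr1.
  by rewrite (_ : _ + _ = 0) ?expR0//; ring.
by rewrite (_ : _ + _ = 0) ?expR0//; ring.
Qed.

Lemma sol_metric_diag (R : realType) (x : 'rV[R]_3) (i j : 'I_3) :
  i != j -> sol_metric x i j = 0.
Proof. by move=> ij; rewrite /sol_metric mxE (negbTE ij). Qed.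

Definition sol_cometric (R : realType) (x : 'rV[R]_3) : 'M[R]_3 :=
  diag_mx (\row_i frame_coef i x ^+ 2).

Lemma mul_sol_metric_cometric (R : realType) (x : 'rV[R]_3) :
  sol_metric x *m sol_cometric x = 1%:M.
Proof.
apply/matrixP => i j; rewrite mul_mx_diag [LHS]mxE [RHS]mxE [(\row__ _) _ _]mxE.
have [<-|ij] := eqVneq i j; last by rewrite sol_metric_diag// mul0r.
by rewrite sol_metric_frame_coef.
Qed.

Lemma invmx_sol_metric (R : realType) (x : 'rV[R]_3) :
  invmx (sol_metric x) = sol_cometric x.
Proof.
have GQ := mul_sol_metric_cometric x; have [Gu _] := mulmx1_unit GQ.
by rewrite -[LHS]mulmx1 -GQ mulKmx.
Qed.

Lemma partial_sol_metric (R : realType) (x : 'rV[R]_3) (l i j : 'I_3) :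
  partial l (fun y => sol_metric y i j) x =
  - 2 * (l == 2)%:R * sol_weight R i * sol_metric x i j.
Proof.
have [<-|ij] := eqVneq i j; last first.
  rewrite sol_metric_diag// mulr0.
  have -> : (fun y => sol_metric y i j) = cst (0 : R).
    by apply/funext => y; exact: sol_metric_diag.
  by rewrite /partial derive_cst.
pose e : 'rV[R]_3 -> R := frame_coef i.
pose g : 'rV[R]_3 -> R := fun y => sol_metric y i i.
have dg : differentiable g x.
  have [dG _] := @sol_metric_smooth R 1%N.
  exact: (differentiable_comp (dG x I) (differentiable_coord _ i i)).
have de : differentiable e x by exact: differentiable_frame_coef.
(* Differentiating the relation g e^2 = 1 handles the three diagonal entries uniformly. *)
have : partial l (g * (e * e)) x = 0.
  rewrite (_ : g * _ = cst (1 : R)) ?/partial ?derive_cst//.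
  by apply/funext => y; rewrite !fctE -expr2 sol_metric_frame_coef.
have dgv : derivable g x (delta_mx 0 l) by exact: diff_derivable.
have dev : derivable e x (delta_mx 0 l) by exact: diff_derivable.
rewrite /partial deriveM//; last exact: derivableM.
rewrite deriveM// -['D__ e x]/(partial l (frame_coef i) x) partial_frame_coef.
rewrite /GRing.scale/= !fctE -/(e x) -/(g x).
have ge : g x * e x ^+ 2 = 1 by exact: sol_metric_frame_coef.
have e0 : e x * e x != 0 by rewrite mulf_neq0// gt_eqF// expR_gt0.
move=> E; apply: (mulIf e0); move: E; move: ('D__ g x) => d E.
by apply/eqP; rewrite -subr_eq0 -[X in _ == X]E; apply/eqP; ring.
Qed.

(** The inverse metric is diagonal, so the tension meets only symbols with equal lower indices. *)
Lemma sol_christoffel_diag (R : realType) (x : 'rV[R]_3) (k i : 'I_3) :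
  christoffel (@sol_metric R) k i i x =
  (k == 2)%:R * sol_weight R i * sol_metric x i i.
Proof.
rewrite /christoffel invmx_sol_metric (bigD1 k)//= big1 => [|l lk]; last first.
  by rewrite mxE eq_sym (negbTE lk) mul0r.
have -> : sol_cometric x k k = frame_coef k x ^+ 2 by rewrite !mxE eqxx.
rewrite addr0 !partial_sol_metric.
have w2 j : (j == 2)%:R * sol_weight R j = 0.
  by have [->|_] := eqVneq j 2; rewrite ?mulr0// mul0r.
rewrite -(mulrA (- 2)) w2 mulr0 mul0r add0r add0r.
have [->|_] := eqVneq k 2; last by rewrite mulr0 !mul0r oppr0 !mulr0.
by rewrite /frame_coef mul0r expR0 expr1n /=; field.
Qed.

(** The coordinates of Sol are harmonic, again because the weights sum to zero, so its Christoffel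
    symbols leave no trace; the inverse metric is absorbed into the frame Jacobian. *)
Lemma tension_sol (R : realType) (H : 'rV[R]_2 -> 'M[R]_2)
    (F : 'rV[R]_3 -> 'rV[R]_2) (x : 'rV[R]_3) (a : 'I_2) :
  tension (@sol_metric R) H F x 0 a =
  \sum_i frame_coef i x ^+ 2 * partial i (partial i (fun t => F t 0 a)) x +
  \sum_b \sum_c christoffel H a b c (F x) *
    (frame_jacobian F x *m (frame_jacobian F x)^T) b c.
Proof.
rewrite mxE.
transitivity (\sum_i frame_coef i x ^+ 2 *
    second_fundamental_form (@sol_metric R) H F a i i x).
  apply: eq_bigr => i _; rewrite invmx_sol_metric (bigD1 i)//= big1 => [|j ji].
    by rewrite addr0 !mxE eqxx.
  by rewrite !mxE eq_sym (negbTE ji) mul0r.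
have lin : \sum_i frame_coef i x ^+ 2 *
    (\sum_k christoffel (@sol_metric R) k i i x *
       partial k (fun t => F t 0 a) x) = 0.
  have w0 : \sum_i sol_weight R i = 0.
    by rewrite sum_ord3 /sol_weight/= addNr addr0.
  transitivity (\sum_i sol_weight R i * partial 2 (fun t => F t 0 a) x); last first.
    by rewrite -mulr_suml w0 mul0r.
  apply: eq_bigr => i _; rewrite (bigD1 2)//= big1 => [|k /negbTE k2]; last first.
    by rewrite sol_christoffel_diag k2 !mul0r.
  rewrite addr0 sol_christoffel_diag eqxx mul1r mulrA; congr (_ * _).
  by rewrite mulrCA mulrC [_ * sol_metric _ _ _]mulrC sol_metric_frame_coef mul1r.
have quad : \sum_i frame_coef i x ^+ 2 * (\sum_b \sum_c
      christoffel H a b c (F x) * partial i (fun t => F t 0 b) x *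
      partial i (fun t => F t 0 c) x) =
    \sum_b \sum_c christoffel H a b c (F x) *
      (frame_jacobian F x *m (frame_jacobian F x)^T) b c.
  under eq_bigr => i _ do rewrite mulr_sumr.
  rewrite exchange_big; apply: eq_bigr => b _ /=.
  under eq_bigr => i _ do rewrite mulr_sumr.
  rewrite exchange_big; apply: eq_bigr => c _ /=.
  rewrite mxE mulr_sumr; apply: eq_bigr => i _.
  by rewrite [(_^T) _ _]mxE !mxE /frame_der; ring.
transitivity (\sum_i (frame_coef i x ^+ 2 *
      partial i (partial i (fun t => F t 0 a)) x -
    frame_coef i x ^+ 2 * (\sum_k christoffel (@sol_metric R) k i i x *
       partial k (fun t => F t 0 a) x) +
    frame_coef i x ^+ 2 * (\sum_b \sum_c
      christoffel H a b c (F x) * partial i (fun t => F t 0 b) x *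
      partial i (fun t => F t 0 c) x))).
  by apply: eq_bigr => i _; rewrite /second_fundamental_form mulrDr mulrBr.
by rewrite big_split sumrB/= lin subr0 quad.
Qed.

Lemma frame_jacobianE (R : realType) (n : nat) (F : 'rV[R]_3 -> 'rV[R]_n) x :
  differentiable F x ->
  frame_jacobian F x = ('J F x)^T *m diag_mx (\row_i frame_coef i x).
Proof.
move=> dF; apply/matrixP => a i; rewrite mul_mx_diag mxE [RHS]mxE mulrC.
rewrite [(\row__ _) _ _]mxE; congr (_ * _); rewrite -partial_entry// mxE.
by rewrite /partial deriveEjacobian// -rowE mxE.
Qed.

Theorem theorem2p2 (R : realType) (N : riemannian_manifold R 2) :
  ~ exists f : sol R -> N, riemannian_submersion f /\ harmonic_map f.
Proof.
case=> f [[[fc fs] fsub] [_ fharm]].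
(* The argument is local: any point serves to make the preimage of a target chart nonempty. *)
pose x0 : 'rV[R]_3 := 0.
have [j jx0] := atlas_cover (f x0).
pose F : 'rV[R]_3 -> 'rV[R]_2 :=
  in_charts (atlas (tt : chart_index (sol R))) (atlas j) f.
pose U : set 'rV[R]_3 := f @^-1` dom (atlas j).
have Uo : open U by apply: open_comp => //; exact: dom_open.
have UV y : U y -> chart_img (atlas j) (F y) by move=> Uy; exists (f y).
have CF : ck_on 2 U F.
  have := fs tt j 2%N; rewrite [X in ck_on _ X _](_ : _ = U)//.
  by rewrite image_id setTI.
have dF y : U y -> differentiable F y by have [+ _] := CF; exact.
have dH z b c : chart_img (atlas j) z ->
    differentiable (fun t => metric j t b c) z.
  have [dm _] := @metric_smooth _ _ N j 1%N.
  by move=> /dm dz; exact: (differentiable_comp dz (differentiable_coord _ b c)).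
have PPH y : U y -> frame_jacobian F y *m (frame_jacobian F y)^T
    *m metric j (F y) = 1%:M.
  move=> Uy; have [Jfull Hsub] := fsub tt j y I Uy.
  have := submersion_dual_metric (sol_metric_sym y) (@sol_metric_pos R y)
    (mul_sol_metric_cometric y) Jfull Hsub.
  rewrite frame_jacobianE; last exact: dF.
  (* The squares of the frame coefficients form the inverse Sol metric, which identifies the two
     Gram matrices. *)
  rewrite trmx_mul trmxK tr_diag_mx => <-; congr (_ *m _).
  rewrite !mulmxA; congr (_ *m _); rewrite -!mulmxA; congr (_ *m _).
  rewrite mulmx_diag; congr diag_mx; apply/rowP => i.
  by rewrite !mxE expr2.
have [|y Uy|v [dv v1 Pv]] := @exists_unit_normal R U (frame_jacobian F).
- by move=> y a i Uy; exact: differentiable_frame_jacobian CF Uy.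
- have [+ _] := mulmx1_unit (PPH y Uy).
  by rewrite unitmxE unitfE.
- apply: (no_unit_killing_field Uo jx0 dv v1) => y Uy.
  have HT z : chart_img (atlas j) z -> (metric j z)^T = metric j z.
    exact: Defs.metric_sym.
  have Vo := @img_open _ _ _ (atlas j).
  apply: (unit_normal_killing Uo Vo UV CF dH HT PPH _ dv v1 Pv Uy).
  move=> z a Uz; rewrite -tension_sol; have := fharm tt j z I Uz.
  by move=> /(congr1 (fun w : 'rV[R]_2 => w 0 a)); rewrite [RHS]mxE.
Qed.
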